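(* The sum-of-divisors function $\sigma(n)$ (for positive integer arguments $n$) can be represented by the arithmetic term $$\mathrm{HW}(M(n))/(n+7)-(n+1)^3,$$ i.e. $\sigma(n)$ equals this expression for every integer $n\ge1$, where $$\begin{aligned}M(n)={}&\mathcal C(n^2,3)+\mathcal A(x_1^2x_3^2,3)+\mathcal A(-2nx_1x_3,3)+\mathcal A(2x_1x_2x_3^2,3)\\&+\mathcal A(x_2^2x_3^2,3)+\mathcal A(-2nx_2x_3,3)+\mathcal A(2x_1x_3^2,3)\\&+\mathcal A(x_3^2,3)+\mathcal A(-2nx_3,3)+\mathcal A(2x_2x_3^2,3),\end{aligned}$$ with $\mathcal C$ and $\mathcal A$ formed with the parameters $t=n+1$ and $w=n+7$.
   Context: $\sigma(n)$ is the sum of the positive divisors of $n$. $\mathrm{HW}(N)$ is the Hamming weight of $N$ (number of ones in its binary representation). $G_r(q,s)=\sum_{j=0}^{s}j^rq^j$ with $0^0=1$; for each fixed $r$ this has a closed form. Given parameters $t>1$, $w$ (depending on the arguments) and $k\ge1$: $$\mathcal C(\varepsilon,k)=(2^w-\varepsilon+1)\,\frac{2^{2wt^k}-1}{2^w+1},$$ and for a monomial $\mu=\alpha\, b_1^{\beta_1x_1}\cdots b_k^{\beta_kx_k}x_1^{\gamma_1}\cdots x_k^{\gamma_k}$ in the formal variables $x_1,\dots,x_k$ (with $\alpha$ an integer possibly negative, and absent exponential factors meaning $\beta_i=0$, absent powers meaning $\gamma_i=0$), $$\mathcal A(\mu,k)=-(2^w-1)\,\alpha\prod_{i=1}^kG_{\gamma_i}\!\left(2^{2wt^{i-1}}b_i^{\beta_i},\,t-1\right).$$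 An arithmetic term is an expression built from natural-number constants and the variables by the operations $x+y$, $\max(x-y,0)$, $\lfloor x/y\rfloor$, $x^y$ (with $0^0=1$, $\lfloor x/0\rfloor=0$). Products, $\mathrm{HW}$ and $G_r$ (fixed $r$) are expressible by arithmetic terms and are used as abbreviations; formulas are written with ordinary subtraction and exact division for readability. *)

(* Defs.v *)
From mathcomp Require Import all_boot all_order all_algebra.

Set Implicit Arguments.
Unset Strict Implicit.
Unset Printing Implicit Defensive.

Import GRing.Theory Num.Theory.

(* Arithmetic terms in k variables. ssrnat's conventions are the wanted ones:  *)
(* m - n is truncated, m %/ 0 = 0 and 0 ^ 0 = 1.                               *)
Inductive aterm (k : nat) : Type :=
| AVar of 'I_k
| AConst of nat
| AAdd of aterm k & aterm k
| ASub of aterm k & aterm k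
| ADiv of aterm k & aterm k
| AExp of aterm k & aterm k.

Arguments AConst {k}.

Fixpoint aeval (k : nat) (x : 'I_k -> nat) (T : aterm k) : nat :=
  match T with
  | AVar i => x i
  | AConst c => c
  | AAdd T1 T2 => aeval x T1 + aeval x T2
  | ASub T1 T2 => aeval x T1 - aeval x T2
  | ADiv T1 T2 => aeval x T1 %/ aeval x T2
  | AExp T1 T2 => aeval x T1 ^ aeval x T2
  end.

Fixpoint asubst (k l : nat) (S : 'I_k -> aterm l) (T : aterm k) : aterm l :=
  match T with
  | AVar i => S i
  | AConst c => AConst c
  | AAdd T1 T2 => AAdd (asubst S T1) (asubst S T2)
  | ASub T1 T2 => ASub (asubst S T1) (asubst S T2)
  | ADiv T1 T2 => ADiv (asubst S T1) (asubst S T2)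
  | AExp T1 T2 => AExp (asubst S T1) (asubst S T2)
  end.

Definition avar1 : aterm 1 := AVar ord0.

Definition aeval1 (T : aterm 1) (n : nat) : nat := aeval (fun _ => n) T.

Definition acomp (T S : aterm 1) : aterm 1 := asubst (fun _ => S) T.

Definition sigma (n : nat) : nat := \sum_(d <- divisors n) d.

(* As N < 2 ^ N, every nonzero binary digit of N has a position i < N.         *)
Definition HW (N : nat) : nat := \sum_(i < N) odd (N %/ 2 ^ i).

Definition G (r q s : nat) : nat := \sum_(0 <= j < s.+1) j ^ r * q ^ j.

Local Open Scope ring_scope.

(* coef * \prod_i (base i ^ (bexp i * x_i)) * \prod_i (x_i ^ xexp i), where    *)
(* the variable x_(i+1) of the usual numbering x_1, ..., x_k has index i : 'I_k.*)
Record monomial (k : nat) : Type := Monomial {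
  coef : int;
  base : 'I_k -> nat;
  bexp : 'I_k -> nat;
  xexp : 'I_k -> nat }.

(* A monomial without exponential factors: the bases are irrelevant since the  *)
(* exponents bexp vanish.                                                      *)
Definition xmon (k : nat) (a : int) (g : k.-tuple nat) : monomial k :=
  Monomial a (fun _ => 1%N) (fun _ => 0%N) (tnth g).

(* The division is exact: 2 ^ w + 1 divides 2 ^ (2 * w) - 1, which divides     *)
(* 2 ^ (2 * w * t ^ k) - 1.                                                    *)
Definition calC (t w : nat) (eps : int) (k : nat) : int :=
  (2 ^+ w - eps + 1) * ((2 ^+ (2 * w * t ^ k)%N - 1) %/ (2 ^+ w + 1))%Z.

(* Indices start at 0, so that t ^ i below is the t ^ (i - 1) of the usual     *)
(* numbering i = 1, ..., k.                                                    *)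
Definition calA (t w k : nat) (mu : monomial k) : int :=
  - (2 ^+ w - 1) * coef mu *
  \prod_(i < k)
    (G (xexp mu i) (2 ^ (2 * w * t ^ i) * base mu i ^ bexp mu i) (t - 1))%:Z.

Definition M (n : nat) : int :=
  let C := calC n.+1 (n + 7) in
  let A (a : int) (g : 3.-tuple nat) := calA n.+1 (n + 7) (xmon a g) in
  C (n%:Z ^+ 2) 3
  + A 1              [tuple 2; 0; 2]%N
  + A (- (2 * n%:Z)) [tuple 1; 0; 1]%N
  + A 2              [tuple 1; 1; 2]%N
  + A 1              [tuple 0; 2; 2]%N
  + A (- (2 * n%:Z)) [tuple 0; 1; 1]%N
  + A 2              [tuple 1; 0; 2]%N
  + A 1              [tuple 0; 0; 2]%N
  + A (- (2 * n%:Z)) [tuple 0; 0; 1]%N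
  + A 2              [tuple 0; 1; 2]%N.

(* HW(M(x)) / (x + 7) - (x + 1)^3, for terms HWt and Mt standing for HW and M. *)
Definition sigma_term (HWt Mt : aterm 1) : aterm 1 :=
  ASub (ADiv (acomp HWt Mt) (AAdd avar1 (AConst 7)))
       (AExp (AAdd avar1 (AConst 1)) (AConst 3)).

(* Main.v *)
Require Import Defs.
From mathcomp Require Import all_boot all_order all_algebra.
From mathcomp Require Import zify ring.

Import GRing.Theory Num.Theory.

(** Let [f(x1, x2, x3) = ((x1 + x2 + 1) * x3 - n) ^ 2]. Its zeros in the cube
    [0 <= x1, x2, x3 <= n] are counted by [sigma n]: the value [d = x1 + x2 + 1]
    has to be a divisor of [n], it determines [x3 = n / d], and it is reached by
    exactly [d] pairs [(x1, x2)].

    The number [M n] packs all the values of [f] into one integer. Expanding the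
    square, each monomial contributes a product of three geometric-type sums,
    which is a sum over the cube; adding up, [M n] is written in base
    [2 ^ (2 * w)], with [w = n + 7], with one digit
    [(2 ^ w - 1) * (2 ^ w + 1 - f)] for each point ([M_zero_flag_sum]). As
    [f <= 4 * n ^ 4 <= 2 ^ w], that digit has Hamming weight [2 * w] if [f]
    vanishes and [w] otherwise ([HW_zero_flag]), so the weight of [M n] is
    [w * ((n + 1) ^ 3 + sigma n)] ([HW_M]).

    It remains to see that [HW] and [M] are arithmetic terms. Products come from
    squares. The sums [G r] satisfy a recurrence in [r] with exact divisions
    ([G_rec]), and [M] is a polynomial in such sums, [n] and [2 ^ w]. For [HW], the
    2-adic valuation of the central binomial coefficient ['C(2 * n, n)] is
    [HW n] ([HW_logn_bin]). Extracting one digit of a number known to be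
    [\sum_i c i * X ^ e i] with small [c i] is a division followed by a remainder
    ([digit_extraction]); this one device yields binomial coefficients, as digits
    of [(1 + X) ^ m]; greatest common divisors, as a number of solutions of a
    linear equation read off a product of two geometric sums; and the exponent
    [v] of a power [2 ^ v]. Applied to [gcdn m (2 ^ m)], the largest power of 2
    dividing [m], the last two give the valuation. *)

Local Open Scope nat_scope.

(** * Hamming weights of digit sums *)

Lemma HW_widen (N m : nat) :
  N < 2 ^ m -> HW N = \sum_(0 <= i < m) odd (N %/ 2 ^ i).
Proof.
rewrite /HW -(big_mkord predT (fun i => nat_of_bool (odd (N %/ 2 ^ i)))).
have tail a b : N < 2 ^ a -> \sum_(a <= i < b) odd (N %/ 2 ^ i) = 0.
  move=> ltNa; rewrite big_nat big1 // => i /andP[le_ai _].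
  by rewrite divn_small // (leq_trans ltNa) // leq_exp2l.
move=> ltNm; have [le_mN | /ltnW le_Nm] := leqP m N.
  by rewrite (big_cat_nat (leq0n m) le_mN) /= (tail m N) // addn0.
by rewrite [RHS](big_cat_nat (leq0n N) le_Nm) /= (tail N m) ?addn0 // ltn_expl.
Qed.

Lemma HW_block (l a b : nat) : a < 2 ^ l -> HW (a + 2 ^ l * b) = HW a + HW b.
Proof.
move=> lt_a; have lt_b : b < 2 ^ b by rewrite ltn_expl.
rewrite (@HW_widen _ (l + b)); last first.
  rewrite expnD; have := leq_mul (leqnn (2 ^ l)) lt_b; nia.
rewrite (big_cat_nat (leq0n l) (leq_addr b l)) /= (HW_widen _ l lt_a).
congr (_ + _).
  apply: eq_big_nat => i /andP[_ lt_il].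
  have -> : 2 ^ l * b = (2 ^ (l - i).-1 * b).*2 * 2 ^ i.
    have -> : 2 ^ l = 2 * 2 ^ (l - i).-1 * 2 ^ i by rewrite -expnS -expnD; congr (_ ^ _); lia.
    by rewrite -mul2n; ring.
  by rewrite divnDMl ?expn_gt0 // oddD odd_double addbF.
rewrite (HW_widen _ b lt_b) -{1}[l]add0n big_addn addKn.
apply: eq_bigr => i _; rewrite [i + l]addnC expnD divnMA [2 ^ l * b]mulnC [a + _]addnC.
by rewrite divnMDl ?expn_gt0 // (divn_small lt_a) addn0.
Qed.

Lemma HW0 : HW 0 = 0. Proof. by rewrite /HW big_ord0. Qed.

Lemma HW_bit (b : bool) (m : nat) : HW (b + m.*2) = b + HW m.
Proof.
rewrite -mul2n (HW_block 1) ?expn1; last by case: b.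
by case: b; rewrite /HW ?big_ord0 // big_ord1.
Qed.

Lemma HW_compl (w x : nat) : x < 2 ^ w -> HW x + HW (2 ^ w - 1 - x) = w.
Proof.
elim: w x => [|w IHw] x; first by rewrite expn0 ltnS leqn0 => /eqP->; rewrite HW0.
rewrite expnS => lt_x; have /IHw eq_w : x./2 < 2 ^ w by lia.
have -> : 2 * 2 ^ w - 1 - x = (~~ odd x) + (2 ^ w - 1 - x./2).*2.
  by have := odd_double_half x; case: (odd x) => /=; lia.
rewrite -{1}[x]odd_double_half !HW_bit addnACA eq_w.
by case: (odd x).
Qed.

Lemma HW_ones (w : nat) : HW (2 ^ w - 1) = w.
Proof.
by have := @HW_compl w 0; rewrite HW0 subn0; apply; rewrite expn_gt0.
Qed.

(** [(2 ^ w - 1) * m] is [m - 1] followed by the [w]-bit complement of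
    [m - 1], so its weight does not depend on [m]. *)
Lemma HW_mul_ones (w m : nat) : 0 < m <= 2 ^ w -> HW ((2 ^ w - 1) * m) = w.
Proof.
case: m => // m /= lt_m.
have -> : (2 ^ w - 1) * m.+1 = (2 ^ w - 1 - m) + 2 ^ w * m by nia.
by rewrite HW_block 1?addnC ?HW_compl //; lia.
Qed.

(** For [f = 0] the number is [2 ^ (2 * w) - 1], all of whose [2 * w] bits are
    ones. *)
Lemma HW_zero_flag (w f : nat) : f <= 2 ^ w ->
  HW ((2 ^ w - 1) * (2 ^ w + 1 - f)) = w * (1 + (f == 0)).
Proof.
move=> le_f; case: eqP => [-> | /eqP nz_f].
  have -> : (2 ^ w - 1) * (2 ^ w + 1 - 0) = 2 ^ (2 * w) - 1.
    by rewrite mulnC expnM (expnAC 2 2) -mulnn; nia.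
  by rewrite HW_ones; lia.
by rewrite HW_mul_ones; lia.
Qed.

Lemma digit_sum_lt (B m : nat) (d : nat -> nat) :
  (forall i, i < m -> d i < B) -> \sum_(i < m) d i * B ^ i < B ^ m.
Proof.
elim: m => [|m IHm] lt_d; first by rewrite big_ord0 expn0.
rewrite big_ord_recr /= expnSr.
have := IHm (fun i lt_i => lt_d i (ltnW lt_i)); have := lt_d m (ltnSn m).
set S := \sum_(i < m) _; nia.
Qed.

Lemma HW_digit_sum (l m B : nat) (d : nat -> nat) :
  B = 2 ^ l -> (forall i, i < m -> d i < B) ->
  HW (\sum_(i < m) d i * B ^ i) = \sum_(i < m) HW (d i).
Proof.
move=> defB; elim: m => [|m IHm] lt_d; first by rewrite !big_ord0 HW0.
have lt_d' i : i < m -> d i < B by move/ltnW/lt_d.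
rewrite !big_ord_recr /= -IHm // [d m * _]mulnC.
by rewrite {2}defB -expnM HW_block // expnM -defB digit_sum_lt.
Qed.

(** * Sums over a cube of digits *)

(** The exponent is the rank of the point [(a, b, c)] of the cube, read in base [t]. *)
Definition cube_sum (B t : nat) (d : nat -> nat -> nat -> nat) : nat :=
  \sum_(c < t) \sum_(b < t) \sum_(a < t) d a b c * B ^ (a + b * t + c * t ^ 2).

(** Fixing [c], and then [c] and [b], turns the sum into a number written in base
    [B ^ t ^ 2], then [B ^ t], so that [HW_digit_sum] applies three times. *)
Lemma HW_cube_sum (l t : nat) (d : nat -> nat -> nat -> nat) :
  (forall a b c, a < t -> b < t -> c < t -> d a b c < 2 ^ l) ->
  HW (cube_sum (2 ^ l) t d) = \sum_(c < t) \sum_(b < t) \sum_(a < t) HW (d a b c).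
Proof.
move=> lt_d; have [B defB] : {B | B = 2 ^ l} by exists (2 ^ l).
rewrite -defB in lt_d *.
pose row c b := \sum_(a < t) d a b c * B ^ a.
pose plane c := \sum_(b < t) row c b * (B ^ t) ^ b.
have row_lt c b : c < t -> b < t -> row c b < B ^ t.
  by move=> lt_c lt_b; apply: (digit_sum_lt B t (fun a => d a b c)) => a lt_a; apply: lt_d.
have plane_lt c : c < t -> plane c < B ^ t ^ 2.
  by move=> lt_c; rewrite -mulnn expnM; apply: digit_sum_lt => b; apply: row_lt.
have -> : cube_sum B t d = \sum_(c < t) plane c * (B ^ t ^ 2) ^ c.
  apply: eq_bigr => c _; rewrite big_distrl; apply: eq_bigr => b _.
  rewrite !big_distrl; apply: eq_bigr => a _ /=.
  by rewrite -!expnM -!mulnA -!expnD; congr (_ * _ ^ _); ring.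
have defBX m : B ^ m = 2 ^ (l * m) by rewrite defB expnM.
rewrite (HW_digit_sum _ _ _ _ (defBX (t ^ 2))) //; apply: eq_bigr => c _.
rewrite (HW_digit_sum _ _ _ _ (defBX t)) => [|b]; last exact: row_lt.
apply: eq_bigr => b _.
by apply: (HW_digit_sum l t B (fun a => d a b c)) => // a lt_a; apply: lt_d.
Qed.

Definition zeros (t : nat) (f : nat -> nat -> nat -> nat) : nat :=
  \sum_(c < t) \sum_(b < t) \sum_(a < t) (f a b c == 0).

Definition zero_flag_sum (w t : nat) (f : nat -> nat -> nat -> nat) : nat :=
  cube_sum (2 ^ (2 * w)) t (fun a b c => (2 ^ w - 1) * (2 ^ w + 1 - f a b c)).

Lemma HW_zero_flag_sum (w t : nat) (f : nat -> nat -> nat -> nat) :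
  (forall a b c, a < t -> b < t -> c < t -> f a b c <= 2 ^ w) ->
  HW (zero_flag_sum w t f) = w * (t ^ 3 + zeros t f).
Proof.
move=> le_f; rewrite HW_cube_sum; last first.
  move=> a b c _ _ _; apply: (@leq_ltn_trans ((2 ^ w - 1) * (2 ^ w + 1))).
    by rewrite leq_mul2l leq_subr orbT.
  by rewrite mul2n -addnn expnD; have := expn_gt0 2 w; nia.
transitivity (\sum_(c < t) \sum_(b < t) \sum_(a < t) w * (1 + (f a b c == 0))).
  by do 3!(apply: eq_bigr => ? _); rewrite HW_zero_flag ?le_f.
have -> : t ^ 3 = \sum_(c < t) \sum_(b < t) \sum_(a < t) 1.
  by rewrite !big_const_ord !iter_addn_0; ring.
rewrite /zeros -big_split big_distrr; apply: eq_bigr => c _ /=.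
rewrite -big_split big_distrr; apply: eq_bigr => b _ /=.
by rewrite -big_split big_distrr.
Qed.

(** * Counting the zeros *)

Definition defect (n a b c : nat) : nat := absz (((a + b + 1) * c)%N%:Z - n%:Z)%R ^ 2.

Lemma defect_eq0 (n a b c : nat) : (defect n a b c == 0) = ((a + b).+1 * c == n).
Proof. by rewrite /defect expn_eq0 /=; lia. Qed.

(** This is where the summand 7 in [w = n + 7] comes from: the values are at most
    [4 * n ^ 4], and [4 * n ^ 4 <= 2 ^ (n + 7)] for all [n]. *)
Lemma defect_le (n a b c : nat) :
  a < n.+1 -> b < n.+1 -> c < n.+1 -> defect n a b c <= 2 ^ (n + 7).
Proof.
move=> lt_a lt_b lt_c.
have le_n4 : 4 * n ^ 4 <= 2 ^ (n + 7).
  move: {a b c lt_a lt_b lt_c} n => n.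
  (* from 7 on, the left side at most doubles when [n] increases by 1 *)
  case: (ltnP n 7) => [|le7n]; first by do 7!(case: n => [//|n]).
  elim: n le7n => // n IHn; rewrite leq_eqVlt ltnS => /orP[/eqP <- // | le7n].
  rewrite addSn [2 ^ _]expnS; apply: leq_trans _ (leq_mul (leqnn 2) (IHn le7n)).
  have [le2 le3] : 7 * n <= n ^ 2 /\ 7 * n ^ 2 <= n ^ 3.
    by rewrite (expnS n 2) leq_mul2r -mulnn leq_mul2r le7n !orbT.
  have le4 : 7 * n ^ 3 <= n ^ 4 by rewrite (expnS n 3) leq_mul2r le7n orbT.
  have -> : n.+1 ^ 4 = n ^ 4 + 4 * n ^ 3 + 6 * n ^ 2 + 4 * n + 1 by ring.
  lia.
apply: leq_trans le_n4.
have le_dist : absz (((a + b + 1) * c)%N%:Z - n%:Z)%R <= 2 * n ^ 2.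
  have : (a + b + 1) * c <= 2 * n ^ 2 + n by rewrite -mulnn; nia.
  by rewrite -mulnn; nia.
by rewrite /defect (leq_trans (leq_mul le_dist le_dist)) //; lia.
Qed.

Lemma sum_pred1_ord (m k : nat) : k < m -> \sum_(i < m) ((i : nat) == k) = 1.
Proof.
move=> lt_km; rewrite (bigD1 (Ordinal lt_km)) //= eqxx big1 // => i.
by rewrite -val_eqE /= => /negPf->.
Qed.

(** Summing over [x3] first leaves the pairs [(x1, x2)] for which [x1 + x2 + 1]
    divides [n]; each divisor [d] then comes from [x2 < d], with [x1] determined. *)
Lemma zeros_defect (n : nat) : 0 < n -> zeros n.+1 (defect n) = sigma n.
Proof.
move=> n_gt0; rewrite /zeros exchange_big /=.
transitivity (\sum_(b < n.+1) \sum_(a < n.+1) \sum_(d <- divisors n) (d == (a + b).+1)).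
  apply: eq_bigr => b _; rewrite exchange_big /=; apply: eq_bigr => a _.
  have -> : \sum_(d <- divisors n) (d == (a + b).+1) = ((a + b).+1 %| n).
    rewrite dvdn_divisors // -(count_uniq_mem _ (divisors_uniq n)) -sum1_count.
    by rewrite [RHS]big_mkcond; apply: eq_bigr => d _ /=; case: eqP.
  under eq_bigr => c _ do rewrite defect_eq0.
  case: dvdnP => [[q def_n] | ndvd].
    rewrite -[RHS](@sum_pred1_ord n.+1 q); last by nia.
    by apply: eq_bigr => c _; congr nat_of_bool; apply/eqP/eqP; nia.
  by rewrite big1 // => c _; case: eqP => // def_n; case: ndvd; exists (nat_of_ord c); lia.
under eq_bigr => b _ do rewrite exchange_big.
rewrite exchange_big /sigma; apply: eq_big_seq => d /=.
rewrite -dvdn_divisors // => dvd_dn; have le_dn := dvdn_leq n_gt0 dvd_dn.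
have d_gt0 := dvdn_gt0 n_gt0 dvd_dn.
transitivity (\sum_(b < n.+1) (b < d)).
  apply: eq_bigr => b _; case: ltnP => [lt_bd | le_db].
    rewrite -[RHS](@sum_pred1_ord n.+1 (d - b.+1)); last by lia.
    by apply: eq_bigr => a _; congr nat_of_bool; apply/eqP/eqP; lia.
  by rewrite big1 // => a _; case: eqP => //; lia.
rewrite -(big_mkord predT (fun b => nat_of_bool (b < d))).
rewrite (big_cat_nat (leq0n d) (leqW le_dn)) /=.
rewrite (@eq_big_nat _ _ _ 0 d _ (fun=> 1)) => [|b /andP[_ ->] //].
rewrite (@eq_big_nat _ _ _ d n.+1 _ (fun=> 0)) => [|b /andP[le_db _]].
  by rewrite !sum_nat_const_nat subn0 muln1 muln0 addn0.
by rewrite ltnNge le_db.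
Qed.

(** * The number M(n) as a digit sum *)

Lemma G_subn1 (r q t : nat) : 0 < t -> G r q (t - 1) = \sum_(j < t) j ^ r * q ^ j.
Proof. by move=> t_gt0; rewrite /G subn1 prednK // big_mkord. Qed.

(** The factor of index [i] turns [B ^ t ^ i - 1] into [B ^ t ^ i.+1 - 1], so the
    product telescopes. *)
Lemma prod_G0 (B t k : nat) : 0 < t ->
  B ^ t ^ k - 1 = (B - 1) * \prod_(i < k) G 0 (B ^ t ^ i) (t - 1).
Proof.
move=> t_gt0; elim: k => [|k IHk]; first by rewrite big_ord0 expn0 expn1 muln1.
rewrite big_ord_recr /= mulnA -IHk G_subn1 // expnSr expnM !subn1 predn_exp.
by congr (_ * _); apply: eq_bigr => j _; rewrite mul1n.
Qed.

Local Open Scope ring_scope.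

Lemma PoszX (m k : nat) : (m ^ k)%N%:Z = m%:Z ^+ k.
Proof. by rewrite -!natz natrX. Qed.

Lemma G_subn1Z (r q t : nat) : (0 < t)%N ->
  (G r q (t - 1))%:Z = \sum_(j < t) j%:Z ^+ r * q%:Z ^+ j.
Proof.
move=> t_gt0; rewrite G_subn1 // (big_morph Posz PoszD (erefl _)).
by apply: eq_bigr => j _; rewrite PoszM !PoszX.
Qed.

(** Since [2 ^ (2 * w) - 1 = (2 ^ w - 1) * (2 ^ w + 1)], the constant [eps]
    contributes to every digit exactly as a monomial does, up to the shift by
    [2 ^ w + 1]. *)
Lemma calC_prodG (t w : nat) (eps : int) (k : nat) : (0 < t)%N ->
  calC t w eps k = (2 ^+ w - 1) * (2 ^+ w + 1 - eps) *
    \prod_(i < k) (G 0 ((2 ^ (2 * w)) ^ t ^ i) (t - 1))%:Z.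
Proof.
move=> t_gt0; rewrite /calC.
have -> : 2 ^+ (2 * w * t ^ k)%N - 1 =
    (2 ^+ w - 1) * \prod_(i < k) (G 0 ((2 ^ (2 * w)) ^ t ^ i) (t - 1))%:Z
      * (2 ^+ w + 1) :> int.
  have := prod_G0 (2 ^ (2 * w)) t k t_gt0; rewrite -expnM => /(congr1 Posz).
  rewrite PoszM (big_morph Posz PoszM (erefl _)) -!subzn ?expn_gt0 //.
  rewrite -!natrX !natz => ->.
  have -> : (2 ^ (2 * w))%N = (2 ^ w * 2 ^ w)%N by rewrite -expnD addnn mul2n.
  by rewrite PoszM; ring.
rewrite mulzK; first by ring.
by rewrite lt0r_neq0 // ltr_wpDl // exprn_ge0.
Qed.

Lemma calA_xmon (t w k : nat) (a : int) (g : k.-tuple nat) :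
  calA t w (xmon a g) = - (2 ^+ w - 1) * a *
    \prod_(i < k) (G (tnth g i) ((2 ^ (2 * w)) ^ t ^ i) (t - 1))%:Z.
Proof.
congr (_ * _); apply: eq_bigr => i _ /=.
by rewrite expn0 muln1 expnM.
Qed.

(** The linear functional that the constant and the monomials are all values of *)
Definition zcube_sum (B t : nat) (h : nat -> nat -> nat -> int) : int :=
  \sum_(c < t) \sum_(b < t) \sum_(a < t) h a b c * B%:Z ^+ (a + b * t + c * t ^ 2).

Lemma zcube_sumD B t h1 h2 :
  zcube_sum B t h1 + zcube_sum B t h2 = zcube_sum B t (fun a b c => h1 a b c + h2 a b c).
Proof.
rewrite /zcube_sum -big_split; apply: eq_bigr => c _ /=.
rewrite -big_split; apply: eq_bigr => b _ /=.
by rewrite -big_split; apply: eq_bigr => a _ /=; rewrite mulrDl.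
Qed.

Lemma zcube_sumZ B t k h :
  k * zcube_sum B t h = zcube_sum B t (fun a b c => k * h a b c).
Proof.
rewrite /zcube_sum mulr_sumr; apply: eq_bigr => c _ /=.
rewrite mulr_sumr; apply: eq_bigr => b _ /=.
by rewrite mulr_sumr; apply: eq_bigr => a _ /=; rewrite mulrA.
Qed.

Lemma prod3_G (B t g0 g1 g2 : nat) : (0 < t)%N ->
  \prod_(i < 3) (G (tnth [tuple g0; g1; g2]%N i) (B ^ t ^ i) (t - 1))%:Z =
  zcube_sum B t (fun a b c => a%:Z ^+ g0 * b%:Z ^+ g1 * c%:Z ^+ g2).
Proof.
move=> t_gt0; rewrite !big_ord_recl big_ord0 mulr1 !(tnth_nth 0%N) /= !G_subn1Z //.
rewrite mulrA mulrC [X in _ * X]mulrC [X in _ * X]big_distrlr mulr_suml.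
apply: eq_bigr => c _; rewrite mulr_sumr; apply: eq_bigr => b _.
rewrite mulr_sumr; apply: eq_bigr => a _ /=.
have -> : bump 0 (bump 0 0) = 2%N by [].
rewrite expn0 !expn1 !PoszX -!exprM !exprD.
by rewrite (mulnC b) (mulnC c); ring.
Qed.

(** Expanding the square [((x1 + x2 + 1) * x3 - n) ^ 2] gives the ten terms of
    [M n]. *)
Lemma M_zero_flag_sum (n : nat) : M n = (zero_flag_sum (n + 7) n.+1 (defect n))%:Z.
Proof.
rewrite /M calC_prodG // !calA_xmon; set w := (n + 7)%N; set B := (2 ^ (2 * w))%N.
have -> : \prod_(i < 3) (G 0 (B ^ n.+1 ^ i) (n.+1 - 1))%:Z =
    zcube_sum B n.+1 (fun a b c => 1).
  transitivity (zcube_sum B n.+1 (fun a b c => a%:Z ^+ 0 * b%:Z ^+ 0 * c%:Z ^+ 0)) => //.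
  by rewrite -prod3_G //; apply: eq_bigr => -[[|[|[|]]]].
rewrite !prod3_G // !zcube_sumZ !zcube_sumD.
have sumZ (F : 'I_n.+1 -> nat) : (\sum_j F j)%N%:Z = \sum_j (F j)%:Z.
  exact: (big_morph Posz PoszD (erefl _)).
rewrite /zero_flag_sum /cube_sum sumZ; apply: eq_bigr => c _.
rewrite sumZ; apply: eq_bigr => b _; rewrite sumZ; apply: eq_bigr => a _.
rewrite PoszM PoszX; congr (_ * _).
rewrite PoszM -!subzn ?expn_gt0 //; last first.
  by rewrite (leq_trans (defect_le _ _ _ _ _ _ _)) ?leq_addr.
have -> : (defect n a b c)%:Z = (((a + b + 1) * c)%N%:Z - n%:Z) ^+ 2.
  by rewrite /defect PoszX abszE real_normK ?num_real.
rewrite PoszM !PoszD PoszX.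
by ring.
Qed.

Local Close Scope ring_scope.

(** * Digit extraction *)

(** The terms with [e i > k] vanish modulo [X] after the division by [X ^ k]; those
    with [e i < k] add up to less than [X ^ k] because all the [c i] together are
    less than [X]. *)
Lemma digit_extraction (I : finType) (X k : nat) (c e : I -> nat) :
  \sum_i c i < X ->
  (\sum_i c i * X ^ e i) %/ X ^ k %% X = \sum_(i | e i == k) c i.
Proof.
move=> lt_cX; have X_gt0 : 0 < X by apply: leq_ltn_trans lt_cX.
have Xk_gt0 : 0 < X ^ k by rewrite expn_gt0 X_gt0.
have le_sub (P : pred I) : \sum_(i | P i) c i <= \sum_i c i.
  by rewrite [leqRHS](bigID P) leq_addr.
rewrite (bigID (fun i => e i < k)) /= [X in _ + X](bigID (fun i => e i == k)) /=.
set low := \sum_(i | e i < k) _; set mid := \sum_(i | _ && (e i == k)) _.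
set high := \sum_(i | _ && _) _.
have lt_low : low < X ^ k.
  rewrite {}/low; case: k Xk_gt0 {mid high} => [|k] Xk_gt0; first by rewrite big1.
  apply: (@leq_ltn_trans (\sum_(i | e i < k.+1) c i * X ^ k)).
    by apply: leq_sum => i le_ek; rewrite leq_mul2l leq_pexp2l ?orbT.
  rewrite -big_distrl expnS ltn_pmul2r ?expn_gt0 ?X_gt0 //=.
  exact: leq_ltn_trans (le_sub _) lt_cX.
have -> : mid = (\sum_(i | e i == k) c i) * X ^ k.
  rewrite big_distrl; apply: eq_big => [i | i /andP[_ /eqP-> //]].
  by case: eqP => [-> | _]; rewrite ?ltnn ?andbF.
have [q ->] : exists q, high = q * X * X ^ k.
  exists (\sum_(i | ~~ (e i < k) && (e i != k)) c i * X ^ (e i - k.+1)).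
  rewrite !big_distrl; apply: eq_bigr => i.
  rewrite -leqNgt => /andP[le_ke ne_ek] /=.
  rewrite -!mulnA -expnS -expnD; congr (_ * _ ^ _).
  by rewrite subnK // ltn_neqAle eq_sym ne_ek.
rewrite -mulnDl divnDMl // (divn_small lt_low) add0n addnC modnMDl modn_small //.
exact: leq_ltn_trans (le_sub _) lt_cX.
Qed.

Lemma bin_digit (m k X : nat) : 2 ^ m < X -> (1 + X) ^ m %/ X ^ k %% X = 'C(m, k).
Proof.
move=> lt_mX; have sum_bin : \sum_(i < m.+1) 'C(m, i) = 2 ^ m.
  by rewrite (expnDn 1 1); apply: eq_bigr => i _; rewrite !exp1n !muln1.
rewrite expnDn (eq_bigr (fun i : 'I_m.+1 => 'C(m, i) * X ^ i)); last first.
  by move=> i _; rewrite exp1n mul1n.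
rewrite digit_extraction ?sum_bin //.
case: (leqP k m) => [le_km | lt_mk].
  by rewrite (big_pred1 (Ordinal (le_km : k < m.+1))).
rewrite [RHS]bin_small // big1 // => i /eqP eq_ik.
by rewrite bin_small // eq_ik.
Qed.

(** The greatest common divisor counts the solutions of
    [a * j + b * i = a * (b - 1)] with [j < b] and [i < a], that is, the
    multiples of [b] among [a], [2 * a], ..., [b * a]. *)
Lemma gcdn_count (a b : nat) : 0 < a -> 0 < b ->
  \sum_(p : 'I_b * 'I_a | a * p.1 + b * p.2 == a * (b - 1)) 1 = gcdn a b.
Proof.
move=> a_gt0 b_gt0.
transitivity (\sum_(j < b) (b %| a * j.+1)).
  transitivity (\sum_(j < b) \sum_(i < a) (a * j + b * i == a * (b - 1))).
    rewrite pair_big big_mkcond /=; apply: eq_bigr => -[j i] _ /=.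
    by case: eqP.
  (* replacing [j] by [b - 1 - j] turns the equation into [b * i = a * j] *)
  rewrite (reindex_inj rev_ord_inj).
  have -> : \sum_(j < b) (b %| a * j.+1) = \sum_(j < b) (b %| a * j).
    (* the multiples [a * 0] and [a * b] are interchangeable *)
    apply: (@addnI (b %| a * 0)).
    rewrite -(big_ord_recl b (fun j => nat_of_bool (b %| a * j))).
    by rewrite big_ord_recr /= addnC muln0 dvdn0 dvdn_mull.
  apply: eq_bigr => j _ /=; have lt_jb := ltn_ord j.
  have eqE i : (a * (b - j.+1) + b * i == a * (b - 1)) = (b * i == a * j) by nia.
  under eq_bigr => i _ do rewrite eqE.
  case: dvdnP => [[q def_aj] | ndvd_b].
    rewrite -[RHS](@sum_pred1_ord a q); last by nia.
    by apply: eq_bigr => i _; congr nat_of_bool; nia.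
  by rewrite big1 // => i _; case: eqP => // eq_ij; case: ndvd_b; exists i; lia.
have g_gt0 : 0 < gcdn a b by rewrite gcdn_gt0 a_gt0.
have [a' def_a] := dvdnP (dvdn_gcdl a b); have [b' def_b] := dvdnP (dvdn_gcdr a b).
set g := gcdn a b in g_gt0 def_a def_b *.
have co_ba : coprime b' a'.
  rewrite coprime_sym /coprime -(eqn_pmul2r g_gt0) mul1n.
  by rewrite muln_gcdl -def_a -def_b.
transitivity (\sum_(1 <= j < b.+1) (b' %| j)).
  rewrite big_add1 big_mkord; apply: eq_bigr => j _.
  by rewrite {1}def_b {1}def_a mulnAC dvdn_pmul2r // Gauss_dvdr.
rewrite -divn_count_dvd {1}def_b mulKn //.
by move: b_gt0; rewrite def_b muln_gt0 => /andP[].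
Qed.

Lemma G0_prod (X a b s t : nat) :
  G 0 (X ^ a) s * G 0 (X ^ b) t =
  \sum_(p : 'I_s.+1 * 'I_t.+1) X ^ (a * p.1 + b * p.2).
Proof.
rewrite /G !big_mkord big_distrlr pair_bigA; apply: eq_bigr => p _ /=.
by rewrite !mul1n -!expnM -expnD.
Qed.

(** The number of solutions counted by [gcdn_count] is a coefficient of a product
    of two geometric progressions in [X]; there are [a * b < X] terms in all. *)
Lemma gcdn_digit (a b : nat) : 0 < a -> 0 < b ->
  let X := 2 ^ (a * b) in
  G 0 (X ^ a) (b - 1) * G 0 (X ^ b) (a - 1) %/ X ^ (a * (b - 1)) %% X = gcdn a b.
Proof.
move=> a_gt0 b_gt0 X; rewrite -(gcdn_count a b) // G0_prod.
rewrite !subn1 !prednK //.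
have := digit_extraction ('I_b * 'I_a)%type X (a * b.-1) (fun=> 1)
  (fun p => a * p.1 + b * p.2).
rewrite sum1_card card_prod !card_ord mulnC => /(_ (ltn_expl _ (ltnSn 1))) <-.
by congr (_ %/ _ %% _); apply: eq_bigr => p _; rewrite mul1n.
Qed.

(** * Kummer's theorem for the central binomial coefficient *)

(** Legendre's formula: with [q i = n %/ 2 ^ i], the bits are
    [q i - 2 * q i.+1], and their sum telescopes against the valuation, which is
    the sum of the [q i.+1]. *)
Lemma HW_logn_fact (n : nat) : HW n + logn 2 n`! = n.
Proof.
rewrite logn_fact // /HW big_add1 big_mkord.
have halve i : n %/ 2 ^ i = odd (n %/ 2 ^ i) + (n %/ 2 ^ i.+1).*2.
  by rewrite expnSr divnMA divn2 odd_double_half.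
have tele : \sum_(i < n) n %/ 2 ^ i = n + \sum_(i < n) n %/ 2 ^ i.+1.
  rewrite -[n in n + _]divn1 -(big_ord_recl n (fun i => n %/ 2 ^ i)) big_ord_recr /=.
  by rewrite (divn_small (ltn_expl n (ltnSn 1))) addn0.
move: tele; under eq_bigr => i _ do rewrite halve.
rewrite big_split /=; under [X in _ + X = _]eq_bigr => i _ do rewrite -addnn.
rewrite big_split /=; lia.
Qed.

Lemma HW_logn_bin (n : nat) : HW n = logn 2 'C(2 * n, n).
Proof.
have := congr1 (logn 2) (bin_fact (leq_pmull n (isT : 0 < 2))).
rewrite !lognM ?muln_gt0 ?fact_gt0 ?bin_gt0 ?leq_pmull //.
have -> : 2 * n - n = n by lia.
have := HW_logn_fact n; have := HW_logn_fact (2 * n).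
have -> : HW (2 * n) = HW n by rewrite mul2n; apply: (HW_bit false).
lia.
Qed.

Lemma gcdn_exp2 (m : nat) : 0 < m -> gcdn m (2 ^ m) = 2 ^ logn 2 m.
Proof.
move=> m_gt0; have [o co_2o {1}->] := pfactor_coprime (isT : prime 2) m_gt0.
rewrite gcdnC Gauss_gcdr ?coprimeXl // -expn_min.
by rewrite (minn_idPr _) // ltnW // ltn_logl.
Qed.

(** A power [2 ^ v] with known bound [v < m] gives up its exponent: raised to
    the power [m + 1] it becomes [(1 + Y) ^ v] with [Y = 2 ^ (m + 1) - 1], whose
    digit of index 1 in base [Y] is [v]. *)
Lemma log2_digit (m v : nat) : v < m ->
  let Y := 2 ^ m.+1 - 1 in (2 ^ v) ^ m.+1 %/ Y %% Y = v.
Proof.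
move=> lt_vm Y; rewrite -[X in _ %/ X]expn1 -expnM mulnC expnM.
have -> : 2 ^ m.+1 = 1 + Y by rewrite subnKC ?expn_gt0.
rewrite bin_digit ?bin1 // /Y expnS.
have := ltn_exp2l v m (ltnSn 1); have := expn_gt0 2 v; lia.
Qed.

(** * Functions represented by arithmetic terms *)

Definition representable (f : nat -> nat) : Prop :=
  exists T : aterm 1, forall n, aeval1 T n = f n.

Lemma representable_ext f g : f =1 g -> representable f -> representable g.
Proof. by move=> eq_fg [T defT]; exists T => n; rewrite defT eq_fg. Qed.

Lemma representable_id : representable id.
Proof. by exists avar1. Qed.

Lemma representable_const c : representable (fun=> c).
Proof. by exists (AConst c). Qed.

Lemma representable_add f g :
  representable f -> representable g -> representable (fun n => f n + g n).
Proof. by move=> [S dS] [T dT]; exists (AAdd S T) => n; rewrite -dS -dT. Qed.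

Lemma representable_sub f g :
  representable f -> representable g -> representable (fun n => f n - g n).
Proof. by move=> [S dS] [T dT]; exists (ASub S T) => n; rewrite -dS -dT. Qed.

Lemma representable_div f g :
  representable f -> representable g -> representable (fun n => f n %/ g n).
Proof. by move=> [S dS] [T dT]; exists (ADiv S T) => n; rewrite -dS -dT. Qed.

Lemma representable_exp f g :
  representable f -> representable g -> representable (fun n => f n ^ g n).
Proof. by move=> [S dS] [T dT]; exists (AExp S T) => n; rewrite -dS -dT. Qed.

(** Squaring is an instance of exponentiation, so products come from
    [2 * x * y = (x + y) ^ 2 - x ^ 2 - y ^ 2]. *)
Lemma representable_mul f g :
  representable f -> representable g -> representable (fun n => f n * g n).
Proof.
move=> rf rg; pose sqr h := fun n : nat => h n ^ 2.
have r_sqr h : representable h -> representable (sqr h).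
  by move=> rh; apply: representable_exp rh (representable_const 2).
have := representable_div _ _ (representable_sub _ _ (representable_sub _ _
  (r_sqr _ (representable_add _ _ rf rg)) (r_sqr _ rf)) (r_sqr _ rg))
  (representable_const 2).
apply: representable_ext => n; rewrite /sqr sqrnD.
by rewrite -addnA addKn addKn mulKn.
Qed.

Lemma representable_mod f g :
  representable f -> representable g -> representable (fun n => f n %% g n).
Proof.
move=> rf rg; have := representable_sub _ _ rf
  (representable_mul _ _ (representable_div _ _ rf rg) rg).
by apply: representable_ext => n; have := divn_eq (f n) (g n); lia.
Qed.

Lemma representable_sum r (F : 'I_r -> nat -> nat) :
  (forall i, representable (F i)) -> representable (fun n => \sum_(i < r) F i n).
Proof.
move=> rF; elim: (index_enum _) => [|i s IHs].
  by apply: representable_ext (representable_const 0) => n; rewrite big_nil.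
by apply: representable_ext (representable_add _ _ (rF i) IHs) => n; rewrite big_cons.
Qed.

(** Shifting the index of summation by one multiplies [q ^ j] by [q] and expands
    [(j + 1) ^ r] binomially: a recurrence that determines [G r] from the [G i]
    with [i < r]. *)
Lemma G_rec (r q s : nat) :
  q * G r q s + q * \sum_(i < r) 'C(r, i) * G i q s + 0 ^ r =
  G r q s + s.+1 ^ r * q ^ s.+1.
Proof.
have -> : G r q s + s.+1 ^ r * q ^ s.+1 = G r q s.+1.
  by rewrite /G [RHS]big_nat_recr.
rewrite [RHS]/G big_nat_recl //= muln1 addnC; congr (_ + _).
rewrite -mulnDr addnC.
have -> : \sum_(i < r) 'C(r, i) * G i q s + G r q s =
    \sum_(i < r.+1) 'C(r, i) * G i q s.
  by rewrite big_ord_recr /= binn mul1n.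
transitivity (q * \sum_(0 <= j < s.+1) \sum_(i < r.+1) 'C(r, i) * (j ^ i * q ^ j)).
  congr (_ * _); rewrite exchange_big; apply: eq_bigr => i _ /=.
  by rewrite big_distrr.
rewrite big_distrr; apply: eq_bigr => j _ /=.
rewrite expnS mulnCA -[in RHS]add1n expnDn big_distrl !big_distrr /=.
by apply: eq_bigr => i _; rewrite exp1n mul1n; ring.
Qed.

Lemma representable_G (r : nat) (q s : nat -> nat) : (forall n, 1 < q n) ->
  representable q -> representable s -> representable (fun n => G r (q n) (s n)).
Proof.
move=> q_gt1 rq rs; elim/ltn_ind: r => r IHr.
have rS : representable (fun n => (s n).+1).
  by apply: representable_ext (representable_add _ _ rs (representable_const 1)) => n; rewrite addn1.
pose lower n := \sum_(i < r) 'C(r, i) * G i (q n) (s n).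
have r_lower : representable lower.
  apply: representable_sum => i.
  exact: representable_mul _ _ (representable_const _) (IHr _ (ltn_ord i)).
have := representable_div _ _ (representable_sub _ _ (representable_sub _ _
    (representable_mul _ _ (representable_exp _ _ rS (representable_const r))
                           (representable_exp _ _ rq rS))
    (representable_const (0 ^ r)))
    (representable_mul _ _ rq r_lower))
  (representable_sub _ _ rq (representable_const 1)).
apply: representable_ext => n.
have := G_rec r (q n) (s n); rewrite -/(lower n) => recG.
have -> : (s n).+1 ^ r * q n ^ (s n).+1 - 0 ^ r - q n * lower n = G r (q n) (s n) * (q n - 1).
  by have := q_gt1 n; nia.
by rewrite mulnK // subn_gt0.
Qed.

Lemma representable_exp2 f : representable f -> representable (fun n => 2 ^ f n).
Proof. exact: representable_exp (representable_const 2). Qed.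

Lemma representable_gcd f g : (forall n, 0 < f n) -> (forall n, 0 < g n) ->
  representable f -> representable g -> representable (fun n => gcdn (f n) (g n)).
Proof.
move=> f_gt0 g_gt0 rf rg.
have rX := representable_exp2 _ (representable_mul _ _ rf rg).
have X_gt1 n h : 0 < h -> 1 < (2 ^ (f n * g n)) ^ h.
  move=> h_gt0; rewrite -expnM -{1}(expn0 2) ltn_exp2l //.
  by rewrite !muln_gt0 f_gt0 g_gt0.
have r_pred h : representable h -> representable (fun n => h n - 1).
  by move=> rh; apply: representable_sub (representable_const 1).
have := representable_mod _ _ (representable_div _ _ (representable_mul _ _
  (representable_G 0 _ _ (fun n => X_gt1 n _ (f_gt0 n)) (representable_exp _ _ rX rf) (r_pred _ rg))
  (representable_G 0 _ _ (fun n => X_gt1 n _ (g_gt0 n)) (representable_exp _ _ rX rg) (r_pred _ rf)))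
  (representable_exp _ _ rX (representable_mul _ _ rf (r_pred _ rg)))) rX.
by apply: representable_ext => n; apply: gcdn_digit.
Qed.

Lemma representable_logn2 f : (forall n, 0 < f n) ->
  representable f -> representable (fun n => logn 2 (f n)).
Proof.
move=> f_gt0 rf.
have rS : representable (fun n => (f n).+1).
  by apply: representable_ext (representable_add _ _ rf (representable_const 1)) => n; rewrite addn1.
have r2f := representable_exp2 _ rf.
have rY := representable_sub _ _ (representable_exp2 _ rS) (representable_const 1).
have r2v : representable (fun n => gcdn (f n) (2 ^ f n)).
  by apply: representable_gcd => // n; rewrite expn_gt0.
have := representable_mod _ _ (representable_div _ _ (representable_exp _ _ r2v rS) rY) rY.
by apply: representable_ext => n; rewrite gcdn_exp2 // log2_digit // ltn_logl.
Qed.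

Lemma representable_HW : representable HW.
Proof.
have r2n := representable_mul _ _ (representable_const 2) representable_id.
(* the base exceeds the sum [2 ^ (2 * n)] of the coefficients *)
have rX : representable (fun n => 2 ^ (2 * n + 1)).
  exact: representable_exp2 _ (representable_add _ _ r2n (representable_const 1)).
have r_bin : representable (fun n => 'C(2 * n, n)).
  have := representable_mod _ _ (representable_div _ _ (representable_exp _ _
    (representable_add _ _ (representable_const 1) rX) r2n)
    (representable_exp _ _ rX representable_id)) rX.
  by apply: representable_ext => n; rewrite bin_digit // addn1 ltn_exp2l.
apply: representable_ext (representable_logn2 _ _ r_bin) => n; first by rewrite HW_logn_bin.
by rewrite bin_gt0 leq_pmull.
Qed.

Local Open Scope ring_scope.

(** Terms only produce natural numbers; integer values are handled as
    differences. *)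
Definition zrepresentable (g : nat -> int) : Prop :=
  exists f h, [/\ representable f, representable h & forall n, g n = (f n)%:Z - (h n)%:Z].

Lemma zrepresentable_nat f : representable f -> zrepresentable (fun n => (f n)%:Z).
Proof.
by move=> rf; exists f, (fun=> 0%N); split=> // [|n]; [exact: representable_const | rewrite subr0].
Qed.

Lemma zrepresentable_add g1 g2 :
  zrepresentable g1 -> zrepresentable g2 -> zrepresentable (fun n => g1 n + g2 n).
Proof.
move=> [f1 [h1 [rf1 rh1 def1]]] [f2 [h2 [rf2 rh2 def2]]].
exists (fun n => f1 n + f2 n)%N, (fun n => h1 n + h2 n)%N.
by split=> [||n]; [exact: representable_add.. | rewrite def1 def2; lia].
Qed.

Lemma zrepresentable_opp g : zrepresentable g -> zrepresentable (fun n => - g n).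
Proof. by move=> [f [h [rf rh def]]]; exists h, f; split=> // n; rewrite def opprB. Qed.

Lemma zrepresentable_mul g1 g2 :
  zrepresentable g1 -> zrepresentable g2 -> zrepresentable (fun n => g1 n * g2 n).
Proof.
move=> [f1 [h1 [rf1 rh1 def1]]] [f2 [h2 [rf2 rh2 def2]]].
exists (fun n => f1 n * f2 n + h1 n * h2 n)%N, (fun n => f1 n * h2 n + h1 n * f2 n)%N.
split=> [||n]; [| |rewrite def1 def2 !PoszD !PoszM; ring];
  by apply: representable_add; apply: representable_mul.
Qed.

Lemma representable_absz g : (forall n, 0 <= g n) ->
  zrepresentable g -> representable (fun n => `|g n|%N).
Proof.
move=> g_ge0 [f [h [rf rh def]]].
by apply: representable_ext (representable_sub _ _ rf rh) => n; have := g_ge0 n; rewrite def; lia.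
Qed.

Lemma zrepresentable_ext g1 g2 : g1 =1 g2 -> zrepresentable g1 -> zrepresentable g2.
Proof. by move=> eq_g [f [h [rf rh def]]]; exists f, h; split=> // n; rewrite -eq_g def. Qed.

Lemma zrepresentable_prodG (t w : nat -> nat) k (g : k.-tuple nat) :
  (forall n, 0 < t n)%N -> (forall n, 0 < w n)%N ->
  representable t -> representable w ->
  zrepresentable (fun n =>
    \prod_(i < k) (G (tnth g i) ((2 ^ (2 * w n)) ^ t n ^ i) (t n - 1))%:Z).
Proof.
move=> t_gt0 w_gt0 rt rw; elim: (index_enum _) => [|i s IHs].
  apply: zrepresentable_ext (zrepresentable_nat _ (representable_const 1)) => n.
  by rewrite big_nil.
have rG : representable (fun n => G (tnth g i) ((2 ^ (2 * w n)) ^ t n ^ i) (t n - 1)).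
  apply: representable_G => [n||]; last exact: representable_sub (representable_const 1).
    by rewrite -expnM -{1}(expn0 2) ltn_exp2l // !muln_gt0 w_gt0 expn_gt0 t_gt0.
  apply: representable_exp (representable_exp _ _ rt (representable_const i)).
  exact: representable_exp2 _ (representable_mul _ _ (representable_const 2) rw).
apply: zrepresentable_ext (zrepresentable_mul _ _ (zrepresentable_nat _ rG) IHs) => n.
by rewrite big_cons.
Qed.

Lemma zrepresentable_M : zrepresentable M.
Proof.
pose w n := (n + 7)%N.
have w_gt0 n : (0 < w n)%N by rewrite /w addnS.
have rw : representable w.
  exact: representable_add _ _ representable_id (representable_const 7).
have rt : representable succn.
  apply: representable_ext (representable_add _ _ representable_id (representable_const 1)).
  by move=> n; rewrite addn1.
have zc c : zrepresentable (fun=> c%:Z) := zrepresentable_nat _ (representable_const c).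
have zn : zrepresentable (fun n => n%:Z) := zrepresentable_nat _ representable_id.
have z2w : zrepresentable (fun n => 2 ^+ w n).
  apply: zrepresentable_ext (zrepresentable_nat _ (representable_exp2 _ rw)) => n.
  exact: PoszX.
have zones := zrepresentable_add _ _ z2w (zrepresentable_opp _ (zc 1%N)).
have zC : zrepresentable (fun n => calC n.+1 (w n) (n%:Z ^+ 2) 3).
  have zp := zrepresentable_prodG succn w 3 [tuple 0; 0; 0]%N (fun=> isT) w_gt0 rt rw.
  have zeps := zrepresentable_add _ _ (zrepresentable_add _ _ z2w (zc 1%N))
    (zrepresentable_opp _ (zrepresentable_mul _ _ zn zn)).
  apply: zrepresentable_ext (zrepresentable_mul _ _ (zrepresentable_mul _ _ zones zeps) zp) => n.
  rewrite calC_prodG // expr2; congr (_ * _); apply: eq_bigr => i _.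
  by case: i => [[|[|[|]]]].
have zA a (g : 3.-tuple nat) : zrepresentable a ->
    zrepresentable (fun n => calA n.+1 (w n) (xmon (a n) g)).
  move=> za; have zp := zrepresentable_prodG succn w 3 g (fun=> isT) w_gt0 rt rw.
  apply: zrepresentable_ext (zrepresentable_mul _ _ (zrepresentable_mul _ _
    (zrepresentable_opp _ zones) za) zp) => n.
  by rewrite calA_xmon.
have zm2n := zrepresentable_opp _ (zrepresentable_mul _ _ (zc 2%N) zn).
do 9!(apply: zrepresentable_add; last first;
  first by [exact: zA _ _ (zc 1%N) | exact: zA _ _ (zc 2%N) | exact: zA _ _ zm2n]).
exact: zC.
Qed.

(** * The sum of divisors *)

Lemma M_ge0 (n : nat) : 0 <= M n.
Proof. by rewrite M_zero_flag_sum. Qed.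

Lemma HW_M (n : nat) : (0 < n)%N ->
  HW `|M n| = ((n + 7) * ((n + 1) ^ 3 + sigma n))%N.
Proof.
move=> n_gt0; rewrite M_zero_flag_sum absz_nat HW_zero_flag_sum; last exact: defect_le.
by rewrite zeros_defect // addn1.
Qed.

Lemma aeval_asubst (k l : nat) (S : 'I_k -> aterm l) (x : 'I_l -> nat) (T : aterm k) :
  aeval x (asubst S T) = aeval (fun i => aeval x (S i)) T.
Proof. by elim: T => //= T1 -> T2 ->. Qed.

Theorem theorem5p3 :
  (forall n : nat, (0 < n)%N ->
     0 <= M n /\
     (sigma n)%:R
       = (HW `|M n|%N)%:R / (n%:R + 7) - (n%:R + 1) ^+ 3 :> rat)
  /\
  (exists HWt Mt : aterm 1,
     [/\ forall N : nat, aeval1 HWt N = HW N,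
         forall n : nat, (0 < n)%N -> (aeval1 Mt n)%:Z = M n
       & forall n : nat, (0 < n)%N -> sigma n = aeval1 (sigma_term HWt Mt) n]).
Proof.
split=> [n n_gt0 | ].
  split; first exact: M_ge0.
  rewrite HW_M // natrM mulrC natrD mulKf ?natrD ?natrX ?natrD ?addrK //; last first.
    by rewrite -(natrD _ n 7) pnatr_eq0 addnS.
  by rewrite addrC addKr.
have [HWt defHW] := representable_HW.
have [Mt defM] := representable_absz _ M_ge0 zrepresentable_M.
exists HWt, Mt; split=> // n n_gt0; first by rewrite defM gez0_abs ?M_ge0.
have -> : aeval1 (sigma_term HWt Mt) n =
    (aeval1 HWt (aeval1 Mt n) %/ (n + 7) - (n + 1) ^ 3)%N.
  by rewrite /aeval1 /sigma_term /= aeval_asubst.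
by rewrite defHW defM HW_M // mulKn ?addnS // addKn.
Qed.
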